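(* Let $n\ge 2$ be an integer, $k,c_b>0$, $\rho_0>0$, and let $\lambda_{1,0},\dots,\lambda_{n,0}$ be real numbers with $\lambda_{1,0}=\cdots=\lambda_{J,0}<\lambda_{J+1,0}\le\cdots\le\lambda_{n,0}$ for some integer $1\le J\le n$. Consider the system $$\lambda_i'=-\lambda_i^2+\frac{k}{n}(\rho-c_b)\ (i=1,\dots,n),\qquad \rho'=-\rho\lambda,\quad \lambda=\sum_{i=1}^n\lambda_i,\qquad \rho(0)=\rho_0,\ \lambda_i(0)=\lambda_{i,0},$$ and suppose its maximal interval of existence is $[0,t_B)$ with $0<t_B<\infty$. Then $1\le J<n$, $\lim_{t\to t_B^-}\lambda_i(t)=-\infty$ for $1\le i\le J$, and $\lim_{t\to t_B^-}\lambda_i(t)=+\infty$ for $J<i\le n$.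
   Context: Solutions are real-valued and continuously differentiable on $[0,t_B)$. *)

(* Defs.v *)
From Stdlib Require Import Reals Lra Lia.
From Coquelicot Require Import Coquelicot.
Open Scope R_scope.

Fixpoint lam_sum (n : nat) (l : nat -> R -> R) (t : R) : R :=
  match n with
  | O => 0
  | S m => lam_sum m l t + l (S m) t
  end.

(* (l, rho) is a solution on [0, T) of
     l_i' = - l_i^2 + (k/n)(rho - cb),  rho' = - rho * (sum_i l_i),
     rho(0) = rho0, l_i(0) = l0 i  (1 <= i <= n).
   Differentiability is required on (0,T) and (right-)continuity at 0;
   since the right-hand side is continuous, this is exactly a C^1 solution
   on [0,T) (one-sided derivative at 0). *)
Definition is_solution (n : nat) (k cb rho0 : R) (l0 : nat -> R) (T : R)
    (l : nat -> R -> R) (rho : R -> R) : Prop :=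
  rho 0 = rho0 /\
  (forall i, (1 <= i <= n)%nat -> l i 0 = l0 i) /\
  filterlim rho (at_right 0) (locally (rho 0)) /\
  (forall i, (1 <= i <= n)%nat -> filterlim (l i) (at_right 0) (locally (l i 0))) /\
  (forall t, 0 < t < T ->
     (forall i, (1 <= i <= n)%nat ->
        is_derive (l i) t (- (l i t) ^ 2 + k / INR n * (rho t - cb))) /\
     is_derive rho t (- rho t * lam_sum n l t)).

Definition maximal_solution (n : nat) (k cb rho0 : R) (l0 : nat -> R) (tB : R)
    (l : nat -> R -> R) (rho : R -> R) : Prop :=
  is_solution n k cb rho0 l0 tB l rho /\
  (forall T (l' : nat -> R -> R) (rho' : R -> R),
      tB < T -> ~ is_solution n k cb rho0 l0 T l' rho').

(* Main.v *)
Require Import Defs.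
From Stdlib Require Import Reals Lra Lia.
From Coquelicot Require Import Coquelicot.
Open Scope R_scope.

(** Put [m = k / n] and [kap = m cb]. Since [rho > 0], every [l_i] satisfies
    [l_i' >= - l_i ^ 2 - kap], so [atan l_i] decreases at bounded speed and [l_i] has
    a limit in the extended reals at [tB]. If the smallest one, [l_1], stayed bounded
    below, then [rho] and all the [l_i] would be bounded and the solution could be
    continued past [tB] (the Taylor series of the quadratic system converge); hence
    [l_1] tends to minus infinity. Whenever some [l_i] tends to minus infinity,
    [(ln (- l_i))' <= - l_i + kap], so its integral diverges. The remaining
    alternatives are excluded by functions which are bounded below although their
    derivative is at most [K + c l_i] for such an [l_i]:
    - if all the [l_i] are equal, [l_1 ^ 2 / rho];
    - if [l_j > l_1] and [l_j] tends to minus infinity, [- l_j / (l_j - l_1)];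
    - if [l_j] has a finite limit, [- l_j] itself, because then all the [l_i] are
      bounded above, so that [(ln rho)' >= - l_1 - K] and [rho] dominates [- l_1]. *)

(** * Limits from differential inequalities *)


Lemma derive_nonpos_le (f df : R -> R) (s t : R) :
  s <= t -> (forall u, s <= u <= t -> is_derive f u (df u)) ->
  (forall u, s <= u <= t -> df u <= 0) -> f t <= f s.
Proof.
  intros Hst Hd Hn.
  destruct (MVT_gen f s t df) as [c [Hc He]];
    rewrite ?Rmin_left, ?Rmax_right in * by lra.
  - intros u Hu; apply Hd; lra.
  - intros u Hu; apply continuity_pt_filterlim.
    apply (ex_derive_continuous f); exists (df u); apply Hd; lra.
  - pose proof (Hn c Hc). nra.
Qed.

Lemma is_derive_Rminus (f g : R -> R) (t a b : R) :
  is_derive f t a -> is_derive g t b -> is_derive (fun s => f s - g s) t (a - b).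
Proof. apply (is_derive_minus (V := R_NormedModule) f g). Qed.

Lemma le_of_derive_le (f df : R -> R) (c s t : R) :
  s <= t -> (forall u, s <= u <= t -> is_derive f u (df u)) ->
  (forall u, s <= u <= t -> df u <= c) -> f t <= f s + c * (t - s).
Proof.
  intros Hst Hd Hc. enough (f t - c * t <= f s - c * s) by lra.
  apply (derive_nonpos_le (fun t => f t - c * t) (fun t => df t - c)); [exact Hst| |].
  - intros u Hu. apply is_derive_Rminus; [auto|].
    auto_derive; [auto|ring].
  - intros u Hu. specialize (Hc u Hu). lra.
Qed.

Lemma at_leftP (T : R) (P : R -> Prop) :
  at_left T P <-> exists t0, t0 < T /\ forall t, t0 < t < T -> P t.
Proof.
  split.
  - intros [d Hd]. exists (T - d). split; [destruct d; simpl; lra|].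
    intros t Ht. apply Hd; [|lra].
    unfold ball; simpl; unfold AbsRing_ball, abs, minus, plus, opp; simpl.
    apply Rabs_def1; lra.
  - intros [t0 [Ht0 H]].
    assert (Hp : 0 < T - t0) by lra. exists (mkposreal _ Hp); simpl.
    intros t Hb Ht. apply H.
    unfold ball in Hb; simpl in Hb;
      unfold AbsRing_ball, abs, minus, plus, opp in Hb; simpl in Hb.
    apply Rabs_def2 in Hb. lra.
Qed.

Lemma at_left_interval (T : R) (P : R -> Prop) :
  0 < T -> at_left T P -> exists t0, 0 < t0 < T /\ forall t, t0 < t < T -> P t.
Proof.
  intros HT H. apply at_leftP in H. destruct H as [t0 [Ht0 H]].
  exists (Rmax t0 (T / 2)). pose proof (Rmax_l t0 (T / 2)). pose proof (Rmax_r t0 (T / 2)).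
  split.
  - split; [lra|]. apply Rmax_lub_lt; lra.
  - intros t Ht. apply H. lra.
Qed.

(** The limit is the supremum of the values taken on the interval. *)
Lemma monotone_cvg_at_left (f : R -> R) (t0 T M : R) :
  t0 < T -> (forall s t, t0 < s -> s <= t -> t < T -> f s <= f t) ->
  (forall t, t0 < t < T -> f t <= M) ->
  exists L, filterlim f (at_left T) (locally L).
Proof.
  intros H0 Hm HM.
  destruct (completeness (fun y => exists t, t0 < t < T /\ y = f t)) as [L [Hu Hl]].
  - exists M. intros y [t [Ht ->]]. auto.
  - exists (f ((t0 + T) / 2)), ((t0 + T) / 2). split; [lra|reflexivity].
  - exists L. apply filterlim_locally. intros eps.
    assert (exists s, t0 < s < T /\ L - eps < f s) as [s [Hs HLs]].
    { apply Classical_Prop.NNPP. intros Hn.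
      enough (L <= L - eps) by (destruct eps; simpl in *; lra).
      apply Hl. intros y [t [Ht ->]]. apply Rnot_lt_le. intros Hlt.
      apply Hn. exists t. auto. }
    apply at_leftP. exists s. split; [lra|]. intros t Ht.
    assert (f t <= L) by (apply Hu; exists t; split; [lra|reflexivity]).
    assert (f s <= f t) by (apply Hm; lra).
    unfold ball; simpl; unfold AbsRing_ball, abs, minus, plus, opp; simpl.
    apply Rabs_def1; lra.
Qed.

Lemma filterlim_Rplus {T : Type} (F : (T -> Prop) -> Prop) {FF : Filter F}
    (f g : T -> R) (a b : R) :
  filterlim f F (locally a) -> filterlim g F (locally b) ->
  filterlim (fun x => f x + g x) F (locally (a + b)).
Proof.
  intros Hf Hg. apply (filterlim_comp_2 f g Rplus Hf Hg).
  apply (filterlim_plus (V := R_NormedModule) a b).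
Qed.

Lemma filterlim_Rmult {T : Type} (F : (T -> Prop) -> Prop) {FF : Filter F}
    (f g : T -> R) (a b : R) :
  filterlim f F (locally a) -> filterlim g F (locally b) ->
  filterlim (fun x => f x * g x) F (locally (a * b)).
Proof.
  intros Hf Hg. apply (filterlim_comp_2 f g Rmult Hf Hg).
  apply (filterlim_mult (K := R_AbsRing) a b).
Qed.

Lemma is_derive_at_left (f : R -> R) (T v : R) :
  is_derive f T v -> filterlim f (at_left T) (locally (f T)).
Proof.
  intros H. apply (filterlim_filter_le_1 f (filter_le_within (F := locally T) _)).
  apply (ex_derive_continuous f T). exists v; exact H.
Qed.

(* The inequality makes [atan f + (1 + kap) t] nondecreasing. *)
Lemma riccati_trichotomy (f df : R -> R) (kap t0 T : R) :
  0 <= kap -> t0 < T ->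
  (forall t, t0 < t < T -> is_derive f t (df t)) ->
  (forall t, t0 < t < T -> - f t ^ 2 - kap <= df t) ->
  filterlim f (at_left T) (Rbar_locally m_infty) \/
  filterlim f (at_left T) (Rbar_locally p_infty) \/
  exists L : R, filterlim f (at_left T) (locally L).
Proof.
  intros Hk H0 Hd Hr.
  set (psi := fun t => atan (f t) + (1 + kap) * t).
  destruct (monotone_cvg_at_left psi t0 T (PI / 2 + (1 + kap) * T)) as [L HL]; auto.
  - intros s t Hs Hst Ht.
    enough (- psi t <= - psi s) by lra.
    apply (derive_nonpos_le (fun t => - psi t)
             (fun t => - (df t / (1 + f t ^ 2) + (1 + kap)))); auto.
    + intros u Hu. assert (Hu' : t0 < u < T) by lra. specialize (Hd u Hu').
      unfold psi. auto_derive.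
      * exists (df u); exact Hd.
      * replace (Derive (fun x => f x) u) with (df u) by (symmetry; apply is_derive_unique, Hd).
        field. nra.
    + intros u Hu. assert (Hu' : t0 < u < T) by lra. specialize (Hr u Hu').
      (* This is [f ^ 2 + kap <= (1 + kap) (1 + f ^ 2)] combined with the Riccati inequality. *)
      assert (- (1 + kap) <= df u / (1 + f u ^ 2)); [|lra].
      apply Rle_div_r; nra.
  - intros t Ht. unfold psi. pose proof (atan_bound (f t)). nra.
  - set (th := L - (1 + kap) * T).
    assert (Hth : filterlim (fun t => atan (f t)) (at_left T) (locally th)).
    { apply (filterlim_ext (fun t => psi t + - ((1 + kap) * t))).
      { intros t; unfold psi; ring. }
      apply (filterlim_Rplus _ psi (fun t => - ((1 + kap) * t)) L (- ((1 + kap) * T)) HL).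
      apply (is_derive_at_left (fun t => - ((1 + kap) * t)) T (- (1 + kap))).
      auto_derive; [auto|ring]. }
    assert (Hb : - PI / 2 <= th <= PI / 2).
    { split.
      - apply (filterlim_le (F := at_left T) (fun _ => - PI / 2) (fun t => atan (f t)) (- PI / 2) th); auto.
        + apply filter_forall. intros t; pose proof (atan_bound (f t)); lra.
        + apply filterlim_const.
      - apply (filterlim_le (F := at_left T) (fun t => atan (f t)) (fun _ => PI / 2) th (PI / 2)); auto.
        + apply filter_forall. intros t; pose proof (atan_bound (f t)); lra.
        + apply filterlim_const. }
    (* The position of [th], the limit of [atan f], in the closed interval decides: the two
       endpoints correspond to the infinite limits of [f], and inside it [tan] is continuous and
       gives the finite limit [tan th]. *)
    destruct (Req_dec th (- PI / 2)) as [E1|E1]; [left|right; destruct (Req_dec th (PI / 2)) as [E2|E2]; [left|right]].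
    + intros P [M HM]. pose proof (atan_bound M).
      assert (Hlt : th < atan M) by lra.
      pose proof (Hth _ (open_lt _ _ Hlt)) as Hev.
      unfold filtermap in *. revert Hev. apply filter_imp. intros t Ht. apply HM.
      apply Rnot_le_lt. intros [Hle|Hle]; [apply atan_increasing in Hle; lra|].
      rewrite Hle in *. lra.
    + intros P [M HM]. pose proof (atan_bound M).
      assert (Hlt : atan M < th) by lra.
      pose proof (Hth _ (open_gt _ _ Hlt)) as Hev.
      unfold filtermap in *. revert Hev. apply filter_imp. intros t Ht. apply HM.
      apply Rnot_le_lt. intros [Hle|Hle]; [apply atan_increasing in Hle; lra|].
      rewrite Hle in *. lra.
    + exists (tan th).
      apply (filterlim_ext (fun t => tan (atan (f t)))).
      { intros t; apply tan_atan. }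
      apply (filterlim_comp _ _ _ _ _ _ _ _ Hth).
      apply (continuous_tan th). apply Rgt_not_eq, cos_gt_0; lra.
Qed.

(* Since [(ln (- f))' <= - f + kap], the integral of [f] diverges with [ln (- f)]. *)
Lemma riccati_log_bound (f df y dy : R -> R) (kap K c t0 T : R) :
  0 <= kap -> 0 < c -> t0 < T ->
  (forall t, t0 < t < T -> is_derive f t (df t)) ->
  (forall t, t0 < t < T -> - f t ^ 2 - kap <= df t) ->
  filterlim f (at_left T) (Rbar_locally m_infty) ->
  (forall t, t0 < t < T -> is_derive y t (dy t)) ->
  (forall t, t0 < t < T -> dy t <= K + c * f t) ->
  exists C, at_left T (fun t => f t < -1 /\ y t + c * ln (- f t) <= C).
Proof.
  intros Hk Hc H0 Hd Hr Hf Hy Hdy.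
  assert (Hev : at_left T (fun t => f t < -1)).
  { apply (Hf (fun y => y < -1)). exists (-1). auto. }
  apply at_leftP in Hev. destruct Hev as [t1 [Ht1 Hev]].
  set (s := (Rmax t0 t1 + T) / 2).
  assert (Hs : t0 < s /\ t1 < s /\ s < T).
  { unfold s. pose proof (Rmax_l t0 t1). pose proof (Rmax_r t0 t1).
    assert (Rmax t0 t1 < T) by (apply Rmax_lub_lt; auto). lra. }
  (* The value at [s] of the nonincreasing function [F] below, plus a bound on the linear term of
     [F] over the whole interval from [s] to [T]. *)
  exists (y s + c * ln (- f s) - (K + c * kap) * s + Rabs (K + c * kap) * (Rabs s + Rabs T)).
  apply at_leftP. exists s. split; [lra|]. intros t Ht. split; [apply Hev; lra|].
  set (F := fun t => y t + c * ln (- f t) - (K + c * kap) * t).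
  assert (HF : F t <= F s).
  { apply (derive_nonpos_le F (fun t => dy t + c * (df t / f t) - (K + c * kap))); [lra| |].
    - intros u Hu. assert (Hu' : t0 < u < T) by lra. assert (f u < -1) by (apply Hev; lra).
      specialize (Hd u Hu'). specialize (Hy u Hu'). unfold F. auto_derive.
      + repeat split; [eexists; eauto|eexists; eauto|lra].
      + replace (Derive (fun x => f x) u) with (df u) by (symmetry; apply is_derive_unique, Hd).
        replace (Derive (fun x => y x) u) with (dy u) by (symmetry; apply is_derive_unique, Hy).
        field. lra.
    - intros u Hu. assert (Hu' : t0 < u < T) by lra. assert (f u < -1) by (apply Hev; lra).
      specialize (Hr u Hu'). specialize (Hdy u Hu').
      (* Dividing [- f' <= f ^ 2 + kap] by [- f > 1] leaves [- f + kap / (- f)], and the last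
         quotient is at most [kap]. *)
      assert (df u / f u <= - f u + kap); [|nra].
      replace (df u / f u) with ((- df u) / (- f u)) by (field; lra).
      apply Rle_div_l; nra. }
  unfold F in HF.
  assert ((K + c * kap) * t <= Rabs (K + c * kap) * (Rabs s + Rabs T)); [|lra].
  eapply Rle_trans; [apply Rle_abs|]. rewrite Rabs_mult.
  apply Rmult_le_compat_l; [apply Rabs_pos|].
  unfold Rabs; repeat destruct Rcase_abs; lra.
Qed.

(** In the bound [y + c ln (- f) <= C] the logarithm tends to plus infinity, so [y] must tend to
    minus infinity. Applied to a [y] that is bounded below, this yields the contradictions used
    later. *)
Lemma riccati_comparison (f df y dy : R -> R) (kap K c t0 T : R) :
  0 <= kap -> 0 < c -> t0 < T ->
  (forall t, t0 < t < T -> is_derive f t (df t)) ->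
  (forall t, t0 < t < T -> - f t ^ 2 - kap <= df t) ->
  filterlim f (at_left T) (Rbar_locally m_infty) ->
  (forall t, t0 < t < T -> is_derive y t (dy t)) ->
  (forall t, t0 < t < T -> dy t <= K + c * f t) ->
  filterlim y (at_left T) (Rbar_locally m_infty).
Proof.
  intros Hk Hc H0 Hd Hr Hf Hy Hdy.
  destruct (riccati_log_bound f df y dy kap K c t0 T) as [C HC]; auto.
  intros P [M HM]. unfold filtermap.
  (* The threshold is the one beyond which [c ln (- f)] exceeds [C - M], so that [y < M]. *)
  assert (Hev : at_left T (fun t => f t < - exp ((C - M) / c))).
  { apply (Hf (fun y => y < - exp ((C - M) / c))). exists (- exp ((C - M) / c)). auto. }
  generalize (filter_and _ _ HC Hev). apply filter_imp.
  intros t [[H1 H2] H3]. apply HM.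
  assert ((C - M) / c < ln (- f t)).
  { rewrite <- (ln_exp ((C - M) / c)). apply ln_increasing; [apply exp_pos|lra]. }
  apply Rlt_div_l in H; lra.
Qed.

(** * Sign of solutions of scalar linear equations *)

Lemma ball_R (x e y : R) : ball x e y <-> Rabs (y - x) < e.
Proof. reflexivity. Qed.

(** At 0 a solution is only continuous from the right. Freezing its argument in [[0, t]] makes it
    continuous on the whole line, so that integrals and the mean value theorem can be used up to the
    initial time. *)
Lemma continuous_clamp (g : R -> R) (t T : R) :
  0 < t < T -> (forall u, 0 < u < T -> continuous g u) ->
  filterlim g (at_right 0) (locally (g 0)) ->
  forall s, continuous (fun u => g (Rmax 0 (Rmin u t))) s.
Proof.
  intros Ht Hg Hg0 s. apply filterlim_locally. intros eps.
  destruct (Rle_lt_dec s 0) as [Hs|Hs].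
  - destruct (proj1 (filterlim_locally g (g 0)) Hg0 eps) as [d Hd].
    exists d. intros u Hu. assert (Hu' : Rabs (u - s) < d) by exact Hu. apply Rabs_def2 in Hu'.
    rewrite (Rmin_left s), (Rmax_left 0 s) by lra.
    destruct (Rle_lt_dec u 0) as [Hu0|Hu0].
    + rewrite (Rmin_left u), (Rmax_left 0 u) by lra. apply ball_center.
    + rewrite Rmax_right by (apply Rmin_glb; lra).
      assert (0 < Rmin u t) by (apply Rmin_pos; lra).
      pose proof (Rmin_l u t).
      apply Hd; [|lra]. apply ball_R. apply Rabs_def1; lra.
  - set (v := Rmax 0 (Rmin s t)).
    assert (Hv : 0 < v < T).
    { unfold v. rewrite Rmax_right by (apply Rmin_glb; lra).
      assert (0 < Rmin s t) by (apply Rmin_pos; lra).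
      pose proof (Rmin_r s t). lra. }
    (* The clamp is 1-Lipschitz, so a radius that serves for [g] at [v] also serves at [s]. *)
    destruct (proj1 (filterlim_locally g (g v)) (Hg v Hv) eps) as [d Hd].
    exists d. intros u Hu. apply Hd. apply ball_R.
    apply (Rle_lt_trans _ (Rabs (u - s))); [|exact Hu].
    unfold v, Rmax, Rmin, Rabs;
      repeat (destruct Rle_dec || destruct Rcase_abs); lra.
Qed.

(** Integrating factor: with [Phi] the integral of [c] from 0, the product [y exp (- Phi)] is
    constant, so [p = exp (Phi t)]. Later uses need only that [p] is positive. *)
Lemma linear_ode_formula (y c : R -> R) (T : R) :
  (forall t, 0 < t < T -> is_derive y t (c t * y t)) ->
  (forall t, 0 < t < T -> continuous c t) ->
  filterlim y (at_right 0) (locally (y 0)) ->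
  filterlim c (at_right 0) (locally (c 0)) ->
  forall t, 0 < t < T -> exists p, 0 < p /\ y t = y 0 * p.
Proof.
  intros Hy Hc Hy0 Hc0 t Ht.
  set (cl := fun u => Rmax 0 (Rmin u t)).
  assert (Hcl : forall u, 0 <= u <= t -> cl u = u).
  { intros u Hu. unfold cl. rewrite Rmin_left, Rmax_right; lra. }
  assert (HC : forall s, continuous (fun u => c (cl u)) s)
    by exact (continuous_clamp c t T Ht Hc Hc0).
  assert (HY : forall s, continuous (fun u => y (cl u)) s).
  { apply (continuous_clamp y t T Ht); [|exact Hy0].
    intros u Hu. apply (ex_derive_continuous y). eexists; apply Hy; exact Hu. }
  set (Phi := fun s => RInt (fun u => c (cl u)) 0 s).
  assert (HPhi : forall s, is_derive Phi s (c (cl s))).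
  { intros s. apply (is_derive_RInt (fun u => c (cl u)) Phi 0 s); [|apply HC].
    apply filter_forall. intros b. apply (RInt_correct (V := R_CompleteNormedModule)).
    apply (ex_RInt_continuous (V := R_CompleteNormedModule)). intros; apply HC. }
  (* The clamped [y] supplies the continuity required at the endpoints; inside the interval it
     agrees locally with [y], hence has the same derivative. *)
  destruct (MVT_gen (fun s => y (cl s) * exp (- Phi s)) 0 t (fun _ => 0)) as [z [_ Hz]];
    rewrite ?Rmin_left, ?Rmax_right by lra.
  - intros u Hu.
    apply (is_derive_ext_loc (fun s => y s * exp (- Phi s))).
    { apply (filter_imp (fun s => 0 < s /\ s < t)).
      - intros s Hs. rewrite Hcl by lra. reflexivity.
      - apply filter_and; [apply open_gt|apply open_lt]; lra. }
    assert (Hyu : is_derive y u (c u * y u)) by (apply Hy; lra).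
    specialize (HPhi u). rewrite Hcl in HPhi by lra.
    auto_derive.
    + repeat split; eexists; eauto.
    + replace (Derive (fun x => y x) u) with (c u * y u)
        by (symmetry; apply is_derive_unique, Hyu).
      replace (Derive (fun x => Phi x) u) with (c u)
        by (symmetry; apply is_derive_unique, HPhi).
      ring.
  - intros u Hu. apply continuity_pt_filterlim.
    apply (continuous_mult (fun s => y (cl s)) (fun s => exp (- Phi s))); [apply HY|].
    apply (ex_derive_continuous (fun s => exp (- Phi s))).
    specialize (HPhi u). auto_derive. eexists; eauto.
  - rewrite !Hcl in Hz by lra.
    assert (HP0 : Phi 0 = 0) by exact (RInt_point 0 (fun u => c (cl u))).
    rewrite HP0, Ropp_0, exp_0 in Hz.
    exists (exp (Phi t)). split; [apply exp_pos|].
    replace (y 0) with (y t * exp (- Phi t)) by lra.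
    rewrite Rmult_assoc, <- exp_plus. replace (- Phi t + Phi t) with 0 by ring.
    rewrite exp_0; ring.
Qed.

(** * Local existence by power series *)


(** [lam_sum] freed from its time argument, so that it also applies to Taylor coefficients and to
    limits. *)
Fixpoint index_sum (n : nat) (v : nat -> R) : R :=
  match n with
  | O => 0
  | S m => index_sum m v + v (S m)
  end.

Lemma lam_sum_index_sum (n : nat) (l : nat -> R -> R) (t : R) :
  lam_sum n l t = index_sum n (fun i => l i t).
Proof. induction n; simpl; [|rewrite IHn]; reflexivity. Qed.

Lemma index_sum_ext (n : nat) (v w : nat -> R) :
  (forall i, (1 <= i <= n)%nat -> v i = w i) -> index_sum n v = index_sum n w.
Proof.
  intros H. induction n; simpl; [reflexivity|].
  rewrite IHn, H by (intros; try apply H; lia). reflexivity.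
Qed.

Lemma index_sum_le (n : nat) (v : nat -> R) (K : R) :
  (forall i, (1 <= i <= n)%nat -> v i <= K) -> index_sum n v <= INR n * K.
Proof.
  intros H. induction n; simpl index_sum; [simpl; lra|].
  rewrite S_INR. assert (v (S n) <= K) by (apply H; lia).
  assert (index_sum n v <= INR n * K) by (apply IHn; intros; apply H; lia). lra.
Qed.

Lemma index_sum_opp (n : nat) (v : nat -> R) :
  index_sum n (fun i => - v i) = - index_sum n v.
Proof. induction n; simpl; [|rewrite IHn]; ring. Qed.

Lemma index_sum_ge (n : nat) (v : nat -> R) (K : R) :
  (forall i, (1 <= i <= n)%nat -> K <= v i) -> INR n * K <= index_sum n v.
Proof.
  intros H. enough (index_sum n (fun i => - v i) <= INR n * - K)
    by (rewrite index_sum_opp in *; lra).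
  apply index_sum_le. intros i Hi. specialize (H i Hi). lra.
Qed.

(** The first term is kept exact because in the application it tends to minus infinity, while the
    others are only bounded above. *)
Lemma index_sum_le_first (n : nat) (v : nat -> R) (K : R) :
  (1 <= n)%nat -> 0 <= K -> (forall i, (1 <= i <= n)%nat -> v i <= K) ->
  index_sum n v <= v 1%nat + INR n * K.
Proof.
  intros Hn HK H. destruct n as [|n]; [lia|]. clear Hn. induction n.
  - simpl. lra.
  - change (index_sum (S (S n)) v) with (index_sum (S n) v + v (S (S n))).
    rewrite (S_INR (S n)). assert (v (S (S n)) <= K) by (apply H; lia).
    assert (index_sum (S n) v <= v 1%nat + INR (S n) * K) by (apply IHn; intros; apply H; lia).
    lra.
Qed.

Lemma index_sum_Rabs_le (n : nat) (v : nat -> R) (K : R) :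
  (forall i, (1 <= i <= n)%nat -> Rabs (v i) <= K) ->
  Rabs (index_sum n v) <= INR n * K.
Proof.
  intros H. apply Rabs_le. split.
  - enough (index_sum n (fun i => - v i) <= INR n * K)
      by (rewrite index_sum_opp in *; lra).
    apply index_sum_le. intros i Hi. specialize (H i Hi).
    apply Rabs_le_between in H. lra.
  - apply index_sum_le. intros i Hi. specialize (H i Hi).
    apply Rabs_le_between in H. lra.
Qed.

Lemma index_sum_nonneg (n : nat) (v : nat -> R) :
  (forall i, (1 <= i <= n)%nat -> 0 <= v i) -> 0 <= index_sum n v.
Proof.
  intros H. induction n; simpl; [lra|].
  assert (0 <= v (S n)) by (apply H; lia).
  assert (0 <= index_sum n v) by (apply IHn; intros; apply H; lia). lra.
Qed.

Lemma index_sum_ge_term (n i : nat) (v : nat -> R) :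
  (forall i, (1 <= i <= n)%nat -> 0 <= v i) -> (1 <= i <= n)%nat -> v i <= index_sum n v.
Proof.
  intros H Hi. induction n; [lia|]. simpl.
  assert (0 <= v (S n)) by (apply H; lia).
  assert (0 <= index_sum n v) by (apply index_sum_nonneg; intros; apply H; lia).
  destruct (Nat.eq_dec i (S n)) as [->|Hne]; [lra|].
  assert (v i <= index_sum n v) by (apply IHn; [intros; apply H|]; lia). lra.
Qed.

(* Taylor coefficients of the solution, from those of order at most [k] to the
   one of order [k + 1]; index [0] stands for the unknown [rho - c], and the
   indices [1, ..., n] for the [lambda_i]. *)
Definition taylor_step (n : nat) (m c : R) (a : nat -> nat -> R) (k i : nat) : R :=
  match i with
  | O => - sum_f_R0 (fun j => a j O * index_sum n (a (k - j)%nat)) k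
         - c * index_sum n (a k)
  | _ => - sum_f_R0 (fun j => a j i * a (k - j)%nat i) k + m * a k O
  end / INR (S k).

(** Course-of-values recursion: the Cauchy products need all earlier coefficients, so stage [k]
    stores those of order up to [k]. Entries of higher order merely repeat the last one. *)
Fixpoint taylor_table (n : nat) (m c : R) (x0 : nat -> R) (k : nat) : nat -> nat -> R :=
  match k with
  | O => fun _ => x0
  | S k' => fun j => if (j <=? k')%nat then taylor_table n m c x0 k' j
                     else taylor_step n m c (taylor_table n m c x0 k') k'
  end.

Definition taylor_coef (n : nat) (m c : R) (x0 : nat -> R) (k : nat) : nat -> R :=
  taylor_table n m c x0 k k.

Lemma taylor_table_last n m c x0 k :
  taylor_table n m c x0 (S k) (S k) = taylor_step n m c (taylor_table n m c x0 k) k.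
Proof.
  change (taylor_table n m c x0 (S k) (S k)) with
    (if (S k <=? k)%nat then taylor_table n m c x0 k (S k)
     else taylor_step n m c (taylor_table n m c x0 k) k).
  destruct (Nat.leb_spec (S k) k); [lia|reflexivity].
Qed.

Lemma taylor_table_coef n m c x0 k j :
  (j <= k)%nat -> taylor_table n m c x0 k j = taylor_coef n m c x0 j.
Proof.
  induction k; intros Hj.
  - replace j with 0%nat by lia. reflexivity.
  - simpl. destruct (Nat.leb_spec j k) as [H|H]; [auto|].
    replace j with (S k) by lia. symmetry. apply taylor_table_last.
Qed.

Lemma taylor_coef_S n m c x0 k i :
  taylor_coef n m c x0 (S k) i = taylor_step n m c (taylor_coef n m c x0) k i.
Proof.
  unfold taylor_coef at 1. rewrite taylor_table_last.
  unfold taylor_step. f_equal. rewrite !taylor_table_coef by lia.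
  destruct i.
  - f_equal. f_equal. apply sum_eq. intros j Hj.
    rewrite !taylor_table_coef by lia. reflexivity.
  - f_equal. f_equal. apply sum_eq. intros j Hj.
    rewrite !taylor_table_coef by lia. reflexivity.
Qed.

Lemma sum_f_R0_Rabs_le (f : nat -> R) (k : nat) (K : R) :
  (forall j, (j <= k)%nat -> Rabs (f j) <= K) ->
  Rabs (sum_f_R0 f k) <= INR (S k) * K.
Proof.
  intros H. eapply Rle_trans; [apply Rsum_abs|].
  rewrite Rmult_comm, <- sum_cte. apply sum_Rle. auto.
Qed.

(* The [k + 1] terms of the Cauchy product are absorbed by the division by [k + 1]. *)
Lemma taylor_coef_bound n m c x0 (M : R) :
  0 <= m -> 0 <= c -> 0 <= M ->
  (forall i, (i <= n)%nat -> Rabs (x0 i) <= M) ->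
  forall k i, (i <= n)%nat ->
  Rabs (taylor_coef n m c x0 k i) <= M * ((INR n + 1) * (M + c) + m + 1) ^ k.
Proof.
  (* The ratio must dominate [n M + n c], which comes from the equation for [rho - c], and [M + m],
     which comes from the equations for the [lambda_i]; the final 1 makes it positive. *)
  intros Hm Hc HM H0. set (L := (INR n + 1) * (M + c) + m + 1).
  assert (Hn : 0 <= INR n) by apply pos_INR.
  assert (HL : 0 < L) by (unfold L; nra).
  intros k. induction k as [k IH] using (well_founded_induction Wf_nat.lt_wf).
  intros i Hi. destruct k as [|k].
  - simpl. rewrite Rmult_1_r. apply H0, Hi.
  - rewrite taylor_coef_S. unfold taylor_step.
    set (a := taylor_coef n m c x0) in *.
    assert (Hk : 1 <= INR (S k)) by (rewrite S_INR; pose proof (pos_INR k); lra).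
    assert (HLk : 0 < L ^ k) by (apply pow_lt, HL).
    assert (HMk : 0 <= M * L ^ k) by (apply Rmult_le_pos; lra).
    assert (Hs : forall j, (j <= k)%nat -> Rabs (index_sum n (a j)) <= INR n * (M * L ^ j)).
    { intros j Hj. apply index_sum_Rabs_le. intros p Hp. apply IH; lia. }
    assert (Hpow : forall j, (j <= k)%nat -> L ^ j * L ^ (k - j) = L ^ k).
    { intros j Hj. rewrite <- pow_add. f_equal. lia. }
    unfold Rdiv. rewrite Rabs_mult, (Rabs_pos_eq (/ INR (S k)))
      by (left; apply Rinv_0_lt_compat; lra).
    apply Rle_div_l; [lra|].
    replace (M * L ^ S k * INR (S k)) with (INR (S k) * (L * (M * L ^ k))) by (simpl; ring).
    destruct i as [|i].
    + assert (H1 : Rabs (sum_f_R0 (fun j => a j 0%nat * index_sum n (a (k - j)%nat)) k)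
                   <= INR (S k) * (INR n * M * (M * L ^ k))).
      { apply sum_f_R0_Rabs_le. intros j Hj. rewrite Rabs_mult, <- (Hpow j Hj).
        replace (INR n * M * (M * (L ^ j * L ^ (k - j))))
          with ((M * L ^ j) * (INR n * (M * L ^ (k - j)))) by ring.
        apply Rmult_le_compat; try apply Rabs_pos; [apply IH; lia|apply Hs; lia]. }
      assert (H2 : Rabs (c * index_sum n (a k)) <= c * (INR n * (M * L ^ k))).
      { rewrite Rabs_mult, (Rabs_pos_eq c) by lra. apply Rmult_le_compat_l; auto. }
      eapply Rle_trans; [apply Rabs_triang|]. rewrite !Rabs_Ropp.
      (* The linear term is weakened by the factor [k + 1 >= 1] to match the Cauchy product. *)
      assert (c * (INR n * (M * L ^ k)) <= INR (S k) * (c * INR n * (M * L ^ k))).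
      { assert (0 <= c * INR n * (M * L ^ k)) by (repeat apply Rmult_le_pos; lra). nra. }
      assert (INR (S k) * ((INR n * M + c * INR n) * (M * L ^ k)) <= INR (S k) * (L * (M * L ^ k))).
      { apply Rmult_le_compat_l; [lra|]. apply Rmult_le_compat_r; [lra|]. unfold L. nra. }
      lra.
    + assert (H1 : Rabs (sum_f_R0 (fun j => a j (S i) * a (k - j)%nat (S i)) k)
                   <= INR (S k) * (M * (M * L ^ k))).
      { apply sum_f_R0_Rabs_le. intros j Hj. rewrite Rabs_mult, <- (Hpow j Hj).
        replace (M * (M * (L ^ j * L ^ (k - j))))
          with ((M * L ^ j) * (M * L ^ (k - j))) by ring.
        apply Rmult_le_compat; try apply Rabs_pos; apply IH; lia. }
      assert (H2 : Rabs (m * a k 0%nat) <= m * (M * L ^ k)).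
      { rewrite Rabs_mult, (Rabs_pos_eq m) by lra. apply Rmult_le_compat_l; auto.
        apply IH; lia. }
      eapply Rle_trans; [apply Rabs_triang|]. rewrite !Rabs_Ropp.
      assert (m * (M * L ^ k) <= INR (S k) * (m * (M * L ^ k))).
      { assert (0 <= m * (M * L ^ k)) by (repeat apply Rmult_le_pos; lra). nra. }
      assert (INR (S k) * ((M + m) * (M * L ^ k)) <= INR (S k) * (L * (M * L ^ k))).
      { apply Rmult_le_compat_l; [lra|]. apply Rmult_le_compat_r; [lra|]. unfold L. nra. }
      lra.
Qed.

(** The terms [a k (/ L) ^ k] are bounded by [M], so the radius of convergence is at least [/ L]. *)
Lemma CV_radius_geometric (a : nat -> R) (M L x : R) :
  0 < L -> (forall k, Rabs (a k) <= M * L ^ k) -> Rabs x < / L ->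
  Rbar_lt (Rabs x) (CV_radius a).
Proof.
  intros HL Ha Hx. apply (Rbar_lt_le_trans _ (/ L)); [exact Hx|].
  apply (proj1 (CV_radius_bounded a)). exists M. intros k.
  rewrite Rabs_mult, <- RPow_abs, (Rabs_pos_eq (/ L)) by (left; apply Rinv_0_lt_compat, HL).
  rewrite pow_inv. apply Rle_div_l; [apply pow_lt, HL|auto].
Qed.

Lemma PSeries_index_sum (n : nat) (a : nat -> nat -> R) (x : R) :
  (forall i, (1 <= i <= n)%nat -> Rbar_lt (Rabs x) (CV_radius (fun k => a k i))) ->
  ex_pseries (fun k => index_sum n (a k)) x /\
  PSeries (fun k => index_sum n (a k)) x = index_sum n (fun i => PSeries (fun k => a k i) x).
Proof.
  induction n; intros H.
  - assert (Hz : forall y, is_pseries (fun _ : nat => 0) y 0).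
    { intros y. apply (is_series_ext (fun _ => 0)).
      - intros k. unfold scal; simpl; unfold mult; simpl; ring.
      - apply filterlim_ext with (f := fun _ => 0).
        + intros k. rewrite sum_n_const. ring.
        + apply filterlim_const. }
    simpl. split; [exists 0; apply Hz|apply is_pseries_unique, Hz].
  - destruct IHn as [H1 H2]; [intros; apply H; lia|].
    assert (H3 : ex_pseries (fun k => a k (S n)) x) by (apply CV_radius_inside, H; lia).
    simpl. split.
    + apply (ex_pseries_plus _ _ x H1 H3).
    + rewrite <- H2. apply (PSeries_plus _ _ x H1 H3).
Qed.

(** The power series given by the recurrence converge for [Rabs t < / L]. The equations hold on both
    sides of 0, as the later gluing needs a derivative at the junction. Expanding [rho - c] instead
    of [rho] removes the constant term from the system, so one recurrence covers all orders. *)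
Lemma local_solution (n : nat) (m c : R) (l0 : nat -> R) (r0 : R) :
  0 <= m -> 0 <= c ->
  exists d (l : nat -> R -> R) (r : R -> R), 0 < d /\ r 0 = r0 /\
    (forall i, (1 <= i <= n)%nat -> l i 0 = l0 i) /\
    forall t, Rabs t < d ->
      (forall i, (1 <= i <= n)%nat -> is_derive (l i) t (- (l i t) ^ 2 + m * (r t - c))) /\
      is_derive r t (- r t * lam_sum n l t).
Proof.
  intros Hm Hc.
  set (x0 := fun i => match i with O => r0 - c | _ => l0 i end).
  (* Index 0 is added separately because [index_sum] starts at 1. *)
  set (M := index_sum n (fun i => Rabs (x0 i)) + Rabs (x0 O)).
  assert (HM : forall i, (i <= n)%nat -> Rabs (x0 i) <= M).
  { intros i Hi. unfold M. pose proof (Rabs_pos (x0 O)).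
    assert (Hp : forall j, (1 <= j <= n)%nat -> 0 <= Rabs (x0 j)) by (intros; apply Rabs_pos).
    pose proof (index_sum_nonneg n (fun j => Rabs (x0 j)) Hp).
    destruct i as [|i]; [lra|].
    pose proof (index_sum_ge_term n (S i) (fun j => Rabs (x0 j)) Hp ltac:(lia)). cbv beta in *. lra. }
  pose proof (Rabs_pos (x0 O)) as Hx0.
  set (L := (INR n + 1) * (M + c) + m + 1).
  assert (HMpos : 0 <= M) by (specialize (HM O ltac:(lia)); lra).
  assert (HL : 0 < L).
  { assert (0 <= (INR n + 1) * (M + c))
      by (apply Rmult_le_pos; pose proof (pos_INR n); lra).
    unfold L; lra. }
  set (a := taylor_coef n m c x0).
  assert (HCV : forall t i, Rabs t < / L -> (i <= n)%nat ->
            Rbar_lt (Rabs t) (CV_radius (fun k => a k i))).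
  { intros t i Ht Hi. apply (CV_radius_geometric _ M L); auto. intros k.
    apply taylor_coef_bound; auto. }
  exists (/ L), (fun i => PSeries (fun k => a k i)), (fun t => PSeries (fun k => a k O) t + c).
  split; [apply Rinv_0_lt_compat, HL|].
  split; [rewrite PSeries_0; unfold a, taylor_coef; simpl; ring|].
  split; [intros i Hi; rewrite PSeries_0; unfold a, taylor_coef; simpl; destruct i; [lia|reflexivity]|].
  intros t Ht.
  assert (HINR : forall k, INR (S k) <> 0) by (intros k; apply not_0_INR; lia).
  split.
  - intros i Hi.
    replace (- PSeries (fun k => a k i) t ^ 2 + m * (PSeries (fun k => a k O) t + c - c))
      with (PSeries (PS_derive (fun k => a k i)) t); [apply is_derive_PSeries, HCV; auto; lia|].
    assert (Hi' := HCV t i Ht ltac:(lia)). assert (H0' := HCV t O Ht ltac:(lia)).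
    (* The recurrence says coefficientwise that the differentiated series is minus the Cauchy square
       plus [m] times the series for [rho - c]. *)
    rewrite (PSeries_ext _ (PS_plus (PS_opp (PS_mult (fun k => a k i) (fun k => a k i)))
                                    (PS_scal m (fun k => a k O)))).
    + rewrite PSeries_plus, PSeries_opp, PSeries_scal, PSeries_mult; auto; [ring| |].
      * apply ex_pseries_opp, ex_pseries_mult; auto.
      * apply ex_pseries_scal; [apply Rmult_comm|]. apply CV_radius_inside, H0'.
    + intros k. unfold PS_derive, a. rewrite taylor_coef_S. unfold taylor_step.
      destruct i; [lia|]. unfold PS_plus, PS_opp, PS_scal, PS_mult, plus, opp, scal; simpl.
      unfold mult; simpl. field. apply (HINR k).
  - destruct (PSeries_index_sum n a t) as [Hex Hsum]; [intros; apply HCV; auto; lia|].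
    assert (HS : Rbar_lt (Rabs t) (CV_radius (fun k => index_sum n (a k)))).
    { apply (CV_radius_geometric _ (INR n * M) L); auto. intros k. rewrite Rmult_assoc.
      apply index_sum_Rabs_le. intros i Hi. apply taylor_coef_bound; auto. lia. }
    assert (H0' := HCV t O Ht ltac:(lia)).
    rewrite lam_sum_index_sum, <- Hsum.
    replace (- (PSeries (fun k => a k O) t + c) * PSeries (fun k => index_sum n (a k)) t)
      with (PSeries (PS_derive (fun k => a k O)) t + 0).
    { apply (is_derive_plus (V := R_NormedModule) (PSeries (fun k => a k O)) (fun _ => c));
        [apply is_derive_PSeries, H0'|apply (is_derive_const (V := R_NormedModule) c)]. }
    rewrite Rplus_0_r.
    rewrite (PSeries_ext _ (PS_plus (PS_opp (PS_mult (fun k => a k O) (fun k => index_sum n (a k))))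
                                    (PS_scal (- c) (fun k => index_sum n (a k))))).
    + rewrite PSeries_plus, PSeries_opp, PSeries_scal, PSeries_mult; auto; [ring| |].
      * apply ex_pseries_opp, ex_pseries_mult; auto.
      * apply ex_pseries_scal; [apply Rmult_comm|]. exact Hex.
    + intros k. unfold PS_derive, a. rewrite taylor_coef_S. unfold taylor_step.
      unfold PS_plus, PS_opp, PS_scal, PS_mult, plus, opp, scal; simpl.
      unfold mult; simpl. field. apply (HINR k).
Qed.

(** * Continuation of bounded solutions *)


(** The value at [T] is taken from [g], since [f] is controlled only to the left of [T]. *)
Definition glue (T : R) (f g : R -> R) (t : R) : R := if Rlt_dec t T then f t else g t.

Lemma glue_left (T : R) (f g : R -> R) (t : R) : t < T -> glue T f g t = f t.
Proof. intros H. unfold glue. destruct Rlt_dec; [reflexivity|lra]. Qed.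

Lemma glue_right (T : R) (f g : R -> R) (t : R) : T <= t -> glue T f g t = g t.
Proof. intros H. unfold glue. destruct Rlt_dec; [lra|reflexivity]. Qed.

Lemma is_derive_glue_left (T : R) (f g : R -> R) (t v : R) :
  t < T -> is_derive f t v -> is_derive (glue T f g) t v.
Proof.
  intros Ht. apply is_derive_ext_loc.
  apply (filter_imp (fun s => s < T)); [|exact (open_lt _ _ Ht)].
  intros s Hs. symmetry. apply glue_left, Hs.
Qed.

Lemma is_derive_glue_right (T : R) (f g : R -> R) (t v : R) :
  T < t -> is_derive g t v -> is_derive (glue T f g) t v.
Proof.
  intros Ht. apply is_derive_ext_loc.
  apply (filter_imp (fun s => T < s)); [|exact (open_gt _ _ Ht)].
  intros s Hs. symmetry. apply glue_right. lra.
Qed.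

(** The mean value estimate on [[s, t]] passes to the limit as [t] tends to [T]; the value of [f] at
    [T] is replaced by its left limit. *)
Lemma derive_le_at_left (f df : R -> R) (s T x c : R) :
  s < T -> (forall t, s <= t < T -> is_derive f t (df t)) ->
  (forall t, s <= t < T -> df t <= c) ->
  filterlim f (at_left T) (locally x) -> x - f s <= c * (T - s).
Proof.
  intros Hs Hd Hc Hf.
  enough (x <= f s + c * (T - s)) by lra.
  apply (filterlim_le (F := at_left T) f (fun t => f s + c * (t - s)) x (f s + c * (T - s))).
  - apply at_leftP. exists s. split; [exact Hs|]. intros t Ht.
    apply (le_of_derive_le f df); [lra| |]; intros u Hu; [apply Hd|apply Hc]; lra.
  - exact Hf.
  - apply (is_derive_at_left (fun t => f s + c * (t - s)) T c). auto_derive; [auto|ring].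
Qed.

(** To the left of [T] the difference quotients lie between bounds of [df], which tends to [v]; to
    the right they are those of [g]. *)
Lemma is_derive_glue (f df g : R -> R) (t0 T v : R) :
  t0 < T -> (forall t, t0 < t < T -> is_derive f t (df t)) ->
  filterlim df (at_left T) (locally v) ->
  filterlim f (at_left T) (locally (g T)) ->
  is_derive g T v -> is_derive (glue T f g) T v.
Proof.
  intros H0 Hd Hdf Hf Hg. apply is_derive_Reals. apply is_derive_Reals in Hg.
  intros e He. destruct (Hg e He) as [d1 Hd1].
  assert (He2 : 0 < e / 2) by lra.
  assert (Hev := proj1 (filterlim_locally df v) Hdf (mkposreal _ He2)).
  apply at_leftP in Hev. destruct Hev as [t1 [Ht1 Hev]]. simpl in Hev.
  assert (Hev' : forall t, t1 < t < T -> v - e / 2 < df t < v + e / 2).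
  { intros t Ht. assert (Hb : Rabs (df t - v) < e / 2) by exact (Hev t Ht).
    apply Rabs_def2 in Hb. lra. }
  assert (Hp : 0 < Rmin d1 (T - Rmax t0 t1)).
  { apply Rmin_pos; [apply d1|]. assert (Rmax t0 t1 < T) by (apply Rmax_lub_lt; auto). lra. }
  exists (mkposreal _ Hp). simpl. intros h Hh Hhd.
  pose proof (Rmin_l d1 (T - Rmax t0 t1)). pose proof (Rmin_r d1 (T - Rmax t0 t1)).
  pose proof (Rmax_l t0 t1). pose proof (Rmax_r t0 t1).
  rewrite (glue_right _ _ _ T) by lra.
  destruct (Rlt_dec h 0) as [Hneg|Hpos].
  - apply Rabs_def2 in Hhd. rewrite glue_left by lra.
    (* Passing to the limit gives only weak inequalities; [e / 2] leaves room for the strict bound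
       by [e]. *)
    assert (Hup : g T - f (T + h) <= (v + e / 2) * (T - (T + h))).
    { apply (derive_le_at_left f df); auto; [lra| |].
      - intros t Ht. apply Hd. lra.
      - intros t Ht. specialize (Hev' t ltac:(lra)). lra. }
    assert (Hlo : - g T - - f (T + h) <= - (v - e / 2) * (T - (T + h))).
    { apply (derive_le_at_left (fun t => - f t) (fun t => - df t)); [lra| | |].
      - intros t Ht. apply (is_derive_opp (V := R_NormedModule) f t (df t)), Hd. lra.
      - intros t Ht. specialize (Hev' t ltac:(lra)). lra.
      - apply (filterlim_comp _ _ _ f Ropp _ (locally (g T))); [exact Hf|].
        apply (filterlim_opp (V := R_NormedModule)). }
    replace ((f (T + h) - g T) / h - v) with ((g T - f (T + h) - v * (- h)) / (- h))
      by (field; lra).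
    unfold Rdiv. rewrite Rabs_mult, (Rabs_pos_eq (/ - h))
      by (left; apply Rinv_0_lt_compat; lra).
    apply Rlt_div_l; [lra|]. apply Rabs_def1; nra.
  - rewrite glue_right by lra. apply Hd1; [exact Hh|]. lra.
Qed.

(** Since [df >= - K], the function [f + K t] is nondecreasing, and it is bounded. *)
Lemma bounded_derive_cvg (f df : R -> R) (t0 T K : R) :
  0 < t0 < T -> (forall t, t0 < t < T -> is_derive f t (df t)) ->
  (forall t, t0 < t < T -> Rabs (f t) <= K) ->
  (forall t, t0 < t < T -> Rabs (df t) <= K) ->
  exists L, filterlim f (at_left T) (locally L).
Proof.
  intros H0 Hd Hf Hdf.
  assert (HK : 0 <= K).
  { eapply Rle_trans; [apply Rabs_pos|apply (Hf ((t0 + T) / 2))]. lra. }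
  destruct (monotone_cvg_at_left (fun t => f t + K * t) t0 T (K + K * T)) as [L HL].
  - lra.
  - intros s t Hs Hst Ht.
    enough (- (f t + K * t) <= - (f s + K * s)) by lra.
    apply (derive_nonpos_le (fun t => - (f t + K * t)) (fun t => - (df t + K))); [lra| |].
    + intros u Hu. assert (Hdu : is_derive f u (df u)) by (apply Hd; lra).
      auto_derive; [eexists; eauto|].
      replace (Derive (fun x => f x) u) with (df u) by (symmetry; apply is_derive_unique, Hdu).
      ring.
    + intros u Hu. specialize (Hdf u ltac:(lra)). apply Rabs_le_between in Hdf. lra.
  - intros t Ht. specialize (Hf t Ht). apply Rabs_le_between in Hf. nra.
  - exists (L + - (K * T)).
    apply (filterlim_ext (fun t => (f t + K * t) + - (K * t))); [intros; ring|].
    apply filterlim_Rplus; [apply _|exact HL|].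
    apply (is_derive_at_left (fun t => - (K * t)) T (- K)). auto_derive; [auto|ring].
Qed.

Lemma finite_choice (P : nat -> R -> Prop) (n : nat) :
  (forall i, (1 <= i <= n)%nat -> exists x, P i x) ->
  exists L, forall i, (1 <= i <= n)%nat -> P i (L i).
Proof.
  intros H. induction n as [|n IH]; [exists (fun _ => 0); intros; lia|].
  destruct IH as [L HL]; [intros; apply H; lia|].
  destruct (H (S n) ltac:(lia)) as [x Hx].
  exists (fun i => if Nat.eq_dec i (S n) then x else L i). intros i Hi.
  destruct Nat.eq_dec as [->|Hne]; [exact Hx|apply HL; lia].
Qed.

Lemma filterlim_index_sum {T : Type} (F : (T -> Prop) -> Prop) {FF : Filter F}
    (n : nat) (f : nat -> T -> R) (L : nat -> R) :
  (forall i, (1 <= i <= n)%nat -> filterlim (f i) F (locally (L i))) ->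
  filterlim (fun x => index_sum n (fun i => f i x)) F (locally (index_sum n L)).
Proof.
  intros H. induction n; simpl; [apply filterlim_const|].
  apply filterlim_Rplus; [exact FF| |apply H; lia].
  apply IHn. intros; apply H; lia.
Qed.

Lemma is_derive_shift (f : R -> R) (T t v : R) :
  is_derive f (t - T) v -> is_derive (fun s => f (s - T)) t v.
Proof.
  intros H. auto_derive; [eexists; eauto|].
  replace (Derive (fun x => f x) (t + - T)) with v by (symmetry; apply is_derive_unique, H).
  ring.
Qed.

(** Bounded functions make the right-hand sides bounded, so all unknowns have finite limits at [T].
    The local solution started from these limits is glued on. *)
Lemma bounded_solution_extends (n : nat) (k cb rho0 : R) (l0 : nat -> R) (T : R)
    (l : nat -> R -> R) (rho : R -> R) (t0 K : R) :
  (1 <= n)%nat -> 0 <= k -> 0 <= cb -> 0 < t0 < T ->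
  is_solution n k cb rho0 l0 T l rho ->
  (forall t, t0 < t < T -> Rabs (rho t) <= K) ->
  (forall t, t0 < t < T -> forall i, (1 <= i <= n)%nat -> Rabs (l i t) <= K) ->
  exists T' l' rho', T < T' /\ is_solution n k cb rho0 l0 T' l' rho'.
Proof.
  intros Hn Hk Hcb H0 [Hr0 [Hl0 [Hrc [Hlc Hd]]]] Hrb Hlb.
  assert (HnR : 0 < INR n) by (apply lt_0_INR; lia).
  set (m := k / INR n).
  assert (Hm : 0 <= m) by (apply Rdiv_le_0_compat; auto).
  assert (HK : 0 <= K).
  { eapply Rle_trans; [apply Rabs_pos|apply (Hrb ((t0 + T) / 2))]. lra. }
  assert (Hlim : exists L, forall i, (1 <= i <= n)%nat ->
                   filterlim (l i) (at_left T) (locally (L i))).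
  { apply (finite_choice (fun i x => filterlim (l i) (at_left T) (locally x))).
    intros i Hi.
    apply (bounded_derive_cvg (l i) (fun t => - l i t ^ 2 + m * (rho t - cb)) t0 T
             (K + K * K + m * (K + cb))); auto.
    - intros t Ht. apply Hd; auto; lra.
    - intros t Ht. specialize (Hlb t Ht i Hi).
      assert (0 <= m * (K + cb)) by (apply Rmult_le_pos; lra). nra.
    - intros t Ht. specialize (Hlb t Ht i Hi). specialize (Hrb t Ht).
      apply Rabs_le_between in Hlb. apply Rabs_le_between in Hrb.
      apply Rabs_le_between.
      assert (m * (rho t - cb) <= m * (K + cb)) by (apply Rmult_le_compat_l; lra).
      assert (m * - (K + cb) <= m * (rho t - cb)) by (apply Rmult_le_compat_l; lra).
      split; nra. }
  destruct Hlim as [L HL].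
  assert (Hrlim : exists r, filterlim rho (at_left T) (locally r)).
  { apply (bounded_derive_cvg rho (fun t => - rho t * lam_sum n l t) t0 T
             (K + K * (INR n * K))); auto.
    - intros t Ht. apply Hd; lra.
    - intros t Ht. specialize (Hrb t Ht).
      assert (0 <= K * (INR n * K)) by (repeat apply Rmult_le_pos; lra). lra.
    - intros t Ht. rewrite Rabs_mult, Rabs_Ropp, lam_sum_index_sum.
      assert (Rabs (rho t) * Rabs (index_sum n (fun i => l i t)) <= K * (INR n * K)); [|lra].
      apply Rmult_le_compat; try apply Rabs_pos; auto.
      apply index_sum_Rabs_le. intros i Hi. auto. }
  destruct Hrlim as [r Hr].
  (* The system is autonomous, so a solution around 0 may be shifted to start at [T]. *)
  destruct (local_solution n m cb L r Hm Hcb) as [d [l1 [r1 [Hd0 [Hr1 [Hl1 Hd1]]]]]].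
  set (l' := fun i => glue T (l i) (fun t => l1 i (t - T))).
  set (rho' := glue T rho (fun t => r1 (t - T))).
  exists (T + d), l', rho'. split; [lra|].
  assert (Hloc : at_right 0 (fun t => t < T)).
  { apply (filter_le_within (F := locally 0) _ (fun t => t < T)). apply (open_lt T 0). lra. }
  split; [|split; [|split; [|split; [|intros t Htd; split]]]].
  - unfold rho'. rewrite glue_left by lra. exact Hr0.
  - intros i Hi. unfold l'. rewrite glue_left by lra. auto.
  - unfold rho' at 2. rewrite glue_left by lra.
    apply (filterlim_ext_loc rho); [|exact Hrc].
    revert Hloc. apply filter_imp. intros t Ht. symmetry. apply glue_left, Ht.
  - intros i Hi. unfold l' at 2. rewrite glue_left by lra.
    apply (filterlim_ext_loc (l i)); [|apply Hlc, Hi].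
    revert Hloc. apply filter_imp. intros t Ht. symmetry. apply glue_left, Ht.
  - intros i Hi. fold m.
    (* Only [t = T] is delicate: there the right-hand side along the old solution converges to its
       value at the limits, which is the derivative of the new solution. *)
    destruct (Rtotal_order t T) as [Ht|[Ht|Ht]].
    + unfold l', rho'. rewrite !glue_left by lra.
      apply is_derive_glue_left; [exact Ht|]. apply Hd; auto. lra.
    + subst t. unfold l', rho'. rewrite !glue_right by lra.
      apply (is_derive_glue (l i) (fun t => - l i t ^ 2 + m * (rho t - cb)) _ 0 T); [lra| | | |].
      * intros t Ht. apply Hd; auto.
      * rewrite Rminus_diag, Hr1, Hl1 by auto.
        replace (- L i ^ 2 + m * (r - cb)) with (-1 * (L i * L i) + m * (r + - cb)) by ring.
        apply (filterlim_ext (fun t => -1 * (l i t * l i t) + m * (rho t + - cb))); [intros; ring|].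
        apply filterlim_Rplus; [apply _| |].
        -- apply filterlim_Rmult; [apply _|apply filterlim_const|].
           apply filterlim_Rmult; auto; apply _.
        -- apply filterlim_Rmult; [apply _|apply filterlim_const|].
           apply filterlim_Rplus; [apply _|exact Hr|apply filterlim_const].
      * cbv beta. rewrite Rminus_diag, Hl1 by auto. auto.
      * apply is_derive_shift. apply Hd1; auto. rewrite Rminus_diag, Rabs_R0. exact Hd0.
    + unfold l', rho'. rewrite !glue_right by lra.
      apply is_derive_glue_right; [exact Ht|].
      apply (is_derive_shift (l1 i)). apply Hd1; auto. apply Rabs_def1; lra.
  - rewrite lam_sum_index_sum.
    destruct (Rtotal_order t T) as [Ht|[Ht|Ht]].
    + rewrite (index_sum_ext n _ (fun i => l i t))
        by (intros i Hi; unfold l'; apply glue_left, Ht).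
      unfold rho'. rewrite glue_left by lra. rewrite <- lam_sum_index_sum.
      apply is_derive_glue_left; [exact Ht|]. apply Hd. lra.
    + subst t.
      rewrite (index_sum_ext n _ L)
        by (intros i Hi; unfold l'; rewrite glue_right, Rminus_diag by lra; auto).
      unfold rho'. rewrite glue_right, Rminus_diag, Hr1 by lra.
      apply (is_derive_glue rho (fun t => - rho t * lam_sum n l t) _ 0 T); [lra| | | |].
      * intros t Ht. apply Hd; auto.
      * replace (- r * index_sum n L) with (-1 * (r * index_sum n L)) by ring.
        apply (filterlim_ext (fun t => -1 * (rho t * index_sum n (fun i => l i t)))).
        { intros t. rewrite lam_sum_index_sum. ring. }
        apply filterlim_Rmult; [apply _|apply filterlim_const|].
        apply filterlim_Rmult; [apply _|exact Hr|].
        apply filterlim_index_sum; [apply _|exact HL].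
      * cbv beta. rewrite Rminus_diag, Hr1. exact Hr.
      * apply is_derive_shift. rewrite Rminus_diag.
        replace (- r * index_sum n L) with (- r1 0 * lam_sum n l1 0).
        { apply Hd1. rewrite Rabs_R0. exact Hd0. }
        rewrite Hr1, lam_sum_index_sum. f_equal. apply index_sum_ext. auto.
    + rewrite (index_sum_ext n _ (fun i => l1 i (t - T)))
        by (intros i Hi; apply (glue_right T (l i) (fun t => l1 i (t - T))); lra).
      unfold rho'. rewrite glue_right by lra. rewrite <- lam_sum_index_sum.
      apply is_derive_glue_right; [exact Ht|].
      apply (is_derive_shift r1). apply Hd1; auto. apply Rabs_def1; lra.
Qed.


(** * Positivity of the density, preservation of order and a continuation criterion *)

Lemma is_derive_continuous (f : R -> R) (t v : R) : is_derive f t v -> continuous f t.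
Proof. intros H. apply (ex_derive_continuous f). exists v. exact H. Qed.

(** The equation for [rho] is linear in [rho], with a coefficient continuous up to the initial
    time. *)
Lemma solution_rho_pos n k cb rho0 l0 T l rho :
  0 < rho0 -> is_solution n k cb rho0 l0 T l rho -> forall t, 0 < t < T -> 0 < rho t.
Proof.
  intros Hpos [Hr0 [Hl0 [Hrc [Hlc Hd]]]] t Ht.
  destruct (linear_ode_formula rho (fun t => -1 * index_sum n (fun i => l i t)) T)
    with (t := t) as [p [Hp ->]]; auto.
  - intros s Hs. rewrite <- lam_sum_index_sum.
    replace (-1 * lam_sum n l s * rho s) with (- rho s * lam_sum n l s) by ring.
    apply Hd, Hs.
  - intros s Hs. apply filterlim_Rmult; [apply _|apply filterlim_const|].
    apply filterlim_index_sum; [apply _|]. intros i Hi.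
    eapply is_derive_continuous. apply Hd; auto.
  - apply filterlim_Rmult; [apply _|apply filterlim_const|].
    apply filterlim_index_sum; [apply _|exact Hlc].
  - rewrite Hr0. apply Rmult_lt_0_compat; auto.
Qed.

(* [(l_j - l_i)' = - (l_i + l_j) (l_j - l_i)], so the initial order is preserved. *)
Lemma solution_gap n k cb rho0 l0 T l rho i j :
  is_solution n k cb rho0 l0 T l rho -> (1 <= i <= n)%nat -> (1 <= j <= n)%nat ->
  forall t, 0 < t < T -> exists p, 0 < p /\ l j t - l i t = (l0 j - l0 i) * p.
Proof.
  intros [Hr0 [Hl0 [Hrc [Hlc Hd]]]] Hi Hj t Ht.
  rewrite <- (Hl0 i Hi), <- (Hl0 j Hj).
  apply (linear_ode_formula (fun t => l j t - l i t) (fun t => -1 * (l i t + l j t)) T); auto.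
  - intros s Hs. destruct (Hd s Hs) as [Hds _].
    replace (-1 * (l i s + l j s) * (l j s - l i s))
      with ((- l j s ^ 2 + k / INR n * (rho s - cb)) - (- l i s ^ 2 + k / INR n * (rho s - cb)))
      by ring.
    apply is_derive_Rminus; auto.
  - intros s Hs. apply filterlim_Rmult; [apply _|apply filterlim_const|].
    apply filterlim_Rplus; [apply _| |]; eapply is_derive_continuous; apply Hd; auto.
  - apply (filterlim_ext (fun t => l j t + -1 * l i t)); [intros; ring|].
    replace (l j 0 - l i 0) with (l j 0 + -1 * l i 0) by ring.
    apply filterlim_Rplus; [apply _|auto|].
    apply filterlim_Rmult; [apply _|apply filterlim_const|auto].
  - apply filterlim_Rmult; [apply _|apply filterlim_const|].
    apply filterlim_Rplus; auto; apply _.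
Qed.

(* If all the [l i] are bounded below near [T] then [rho], and hence the [l i],
   are bounded above. *)
Lemma bounded_below_extends (n : nat) (k cb rho0 : R) (l0 : nat -> R) (T : R)
    (l : nat -> R -> R) (rho : R -> R) (t0 M : R) :
  (1 <= n)%nat -> 0 <= k -> 0 <= cb -> 0 < rho0 -> 0 < t0 < T ->
  is_solution n k cb rho0 l0 T l rho ->
  (forall t, t0 < t < T -> forall i, (1 <= i <= n)%nat -> M <= l i t) ->
  exists T' l' rho', T < T' /\ is_solution n k cb rho0 l0 T' l' rho'.
Proof.
  intros Hn Hk Hcb Hrho0 H0 Hsol HM.
  pose proof (solution_rho_pos _ _ _ _ _ _ _ _ Hrho0 Hsol) as Hpos.
  assert (HnR : 0 < INR n) by (apply lt_0_INR; lia).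
  set (m := k / INR n).
  assert (Hm : 0 <= m) by (apply Rdiv_le_0_compat; auto).
  assert (Hd := Hsol). destruct Hd as [_ [_ [_ [_ Hd]]]]. fold m in Hd.
  set (t1 := (t0 + T) / 2). assert (Ht1 : t0 < t1 < T) by (unfold t1; lra).
  (* The sum of the [l i] is at least [n M], so [rho exp (n M (t - t1))] is nonincreasing; the
     absolute value covers both signs of [M]. *)
  set (B := rho t1 * exp (Rabs (INR n * M) * T)).
  assert (HB : forall t, t1 <= t < T -> 0 < rho t <= B).
  { intros t Ht. split; [apply Hpos; lra|].
    assert (HE : rho t * exp (INR n * M * (t - t1)) <= rho t1 * exp (INR n * M * (t1 - t1))).
    { apply (derive_nonpos_le (fun t => rho t * exp (INR n * M * (t - t1)))
        (fun t => rho t * exp (INR n * M * (t - t1)) * (INR n * M - lam_sum n l t))); [lra| |].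
      - intros u Hu. destruct (Hd u ltac:(lra)) as [_ Hdu].
        auto_derive; [eexists; eauto|].
        replace (Derive (fun x => rho x) u) with (- rho u * lam_sum n l u)
          by (symmetry; apply is_derive_unique, Hdu).
        unfold Rminus. ring.
      - intros u Hu. assert (0 < rho u) by (apply Hpos; lra).
        pose proof (exp_pos (INR n * M * (u - t1))).
        assert (INR n * M <= lam_sum n l u).
        { rewrite lam_sum_index_sum. apply index_sum_ge. intros i Hi. apply HM; auto; lra. }
        assert (0 < rho u * exp (INR n * M * (u - t1))) by (apply Rmult_lt_0_compat; auto).
        nra. }
    rewrite Rminus_diag, Rmult_0_r, exp_0, Rmult_1_r in HE.
    unfold B.
    replace (rho t) with (rho t * exp (INR n * M * (t - t1)) * exp (- (INR n * M) * (t - t1))).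
    2:{ rewrite Rmult_assoc, <- exp_plus.
        replace (INR n * M * (t - t1) + - (INR n * M) * (t - t1)) with 0 by ring.
        rewrite exp_0. ring. }
    apply Rmult_le_compat; auto.
    - apply Rlt_le, Rmult_lt_0_compat; [apply Hpos; lra|apply exp_pos].
    - left; apply exp_pos.
    - assert (- (INR n * M) * (t - t1) <= Rabs (INR n * M) * T).
      { pose proof (Rle_abs (- (INR n * M))) as Ha. rewrite Rabs_Ropp in Ha.
        apply Rle_trans with (Rabs (INR n * M) * (t - t1)).
        - apply Rmult_le_compat_r; lra.
        - apply Rmult_le_compat_l; [apply Rabs_pos|lra]. }
      destruct H as [H|H]; [left; apply exp_increasing, H|rewrite H; lra]. }
  assert (HB0 : 0 < B) by (specialize (HB t1 ltac:(lra)); lra).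
  set (S1 := index_sum n (fun i => Rabs (l i t1))).
  assert (HS1 : forall i, (1 <= i <= n)%nat -> Rabs (l i t1) <= S1).
  { intros i Hi. apply (index_sum_ge_term n i (fun i => Rabs (l i t1))); auto.
    intros; apply Rabs_pos. }
  assert (HmB : 0 <= m * B) by (apply Rmult_le_pos; lra).
  apply (bounded_solution_extends n k cb rho0 l0 T l rho t1 (B + Rabs M + S1 + m * B * T)); auto.
  - lra.
  - intros t Ht. specialize (HB t ltac:(lra)). rewrite Rabs_pos_eq by lra.
    pose proof (Rabs_pos M). pose proof (HS1 1%nat ltac:(lia)). pose proof (Rabs_pos (l 1%nat t1)).
    assert (0 <= m * B * T) by (apply Rmult_le_pos; lra). lra.
  - intros t Ht i Hi.
    (* Dropping [- l_i ^ 2] and [- m cb] leaves a growth rate of at most [m B]. *)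
    assert (Hup : l i t <= l i t1 + m * B * (t - t1)).
    { apply (le_of_derive_le (l i) (fun t => - l i t ^ 2 + m * (rho t - cb))); [lra| |].
      - intros u Hu. apply Hd; auto; lra.
      - intros u Hu. specialize (HB u ltac:(lra)).
        assert (m * (rho u - cb) <= m * B) by (apply Rmult_le_compat_l; lra). nra. }
    specialize (HM t ltac:(lra) i Hi). specialize (HS1 i Hi).
    pose proof (Rabs_pos M). pose proof (Rabs_pos (l i t1)).
    assert (m * B * (t - t1) <= m * B * T) by (apply Rmult_le_compat_l; lra).
    assert (0 <= m * B * T) by (apply Rmult_le_pos; lra).
    apply Rabs_le_between in HS1. pose proof (Rle_abs (- M)) as HaM. rewrite Rabs_Ropp in HaM.
    apply Rabs_le_between. lra.
Qed.

Lemma filterlim_m_infty_lt (f : R -> R) (T M : R) :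
  filterlim f (at_left T) (Rbar_locally m_infty) -> at_left T (fun t => f t < M).
Proof. intros H. apply (H (fun y => y < M)). exists M. auto. Qed.

Lemma finite_limit_bounded (f : R -> R) (T L : R) :
  filterlim f (at_left T) (locally L) -> at_left T (fun t => Rabs (f t) < Rabs L + 1).
Proof.
  intros H. generalize (proj1 (filterlim_locally f L) H (mkposreal 1 Rlt_0_1)).
  apply filter_imp. intros t Ht.
  assert (Hb : Rabs (f t - L) < 1) by exact Ht.
  pose proof (Rabs_triang (f t - L) L) as Htr.
  replace (f t - L + L) with (f t) in Htr by ring. lra.
Qed.

(** * Behaviour at the blow-up time *)


Ltac order_side := match goal with |- _ <= _ => lra | |- _ < _ => lra | _ => idtac end.

Lemma is_derive_eq (f : R -> R) (t a b : R) : is_derive f t a -> a = b -> is_derive f t b.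
Proof. intros H <-. exact H. Qed.

Lemma is_derive_Rmult (f g : R -> R) (t a b : R) :
  is_derive f t a -> is_derive g t b ->
  is_derive (fun s => f s * g s) t (a * g t + f t * b).
Proof. intros Hf Hg. apply (is_derive_mult f g t a b Hf Hg). intros x y; apply Rmult_comm. Qed.

Lemma is_derive_Rdiv (f g : R -> R) (t a b : R) :
  is_derive f t a -> is_derive g t b -> g t <> 0 ->
  is_derive (fun s => f s / g s) t ((a * g t - f t * b) / g t ^ 2).
Proof. intros Hf Hg H0. apply (is_derive_div f g t a b Hf Hg H0). Qed.

Lemma is_derive_Ropp (f : R -> R) (t a : R) :
  is_derive f t a -> is_derive (fun s => - f s) t (- a).
Proof. apply (is_derive_opp (V := R_NormedModule) f). Qed.

Lemma is_derive_neg_ln (f : R -> R) (t a : R) :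
  is_derive f t a -> 0 < f t -> is_derive (fun s => - ln (f s)) t (- (a / f t)).
Proof.
  intros Hf Hp. auto_derive; [split; [eexists; eauto|auto]|].
  replace (Derive (fun x => f x) t) with a by (symmetry; apply is_derive_unique, Hf).
  field. lra.
Qed.

(** Discarding the positive term [(k / n) rho] leaves the Riccati inequality with
    [kap = (k / n) cb]. *)
Lemma riccati_solution n k cb rho0 l0 T l rho i t :
  (1 <= n)%nat -> 0 < k -> 0 < cb -> 0 < rho0 ->
  is_solution n k cb rho0 l0 T l rho -> (1 <= i <= n)%nat -> 0 < t < T ->
  is_derive (l i) t (- l i t ^ 2 + k / INR n * (rho t - cb)) /\
  - l i t ^ 2 - k / INR n * cb <= - l i t ^ 2 + k / INR n * (rho t - cb).
Proof.
  intros Hn Hk Hcb Hrho0 Hsol Hi Ht.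
  pose proof (solution_rho_pos _ _ _ _ _ _ _ _ Hrho0 Hsol t Ht).
  assert (0 < k / INR n) by (apply Rdiv_lt_0_compat; auto; apply lt_0_INR; lia).
  destruct Hsol as [_ [_ [_ [_ Hd]]]]. split; [apply Hd; auto|nra].
Qed.

(** In the other two cases of the trichotomy [l 1] is bounded below near [T]. By preservation of
    order so is every [l i], and the solution extends, against maximality. *)
Lemma minimum_tends_to_m_infty n k cb rho0 l0 T l rho :
  (1 <= n)%nat -> 0 < k -> 0 < cb -> 0 < rho0 -> 0 < T ->
  (forall i, (1 <= i <= n)%nat -> l0 1%nat <= l0 i) ->
  maximal_solution n k cb rho0 l0 T l rho ->
  filterlim (l 1%nat) (at_left T) (Rbar_locally m_infty).
Proof.
  intros Hn Hk Hcb Hrho0 HT Hmin [Hsol Hmax].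
  assert (Hkap : 0 < k / INR n * cb).
  { apply Rmult_lt_0_compat; auto. apply Rdiv_lt_0_compat; auto. apply lt_0_INR; lia. }
  assert (Hbd : forall M, ~ at_left T (fun t => M <= l 1%nat t)).
  { intros M HM. destruct (at_left_interval _ _ HT HM) as [t0 [Ht0 Hlow]].
    destruct (bounded_below_extends n k cb rho0 l0 T l rho t0 M) as [T' [l' [rho' [HT' Hs']]]];
      order_side; auto.
    - intros t Ht i Hi. specialize (Hlow t Ht).
      destruct (solution_gap _ _ _ _ _ _ _ _ 1%nat i Hsol ltac:(lia) Hi t ltac:(lra))
        as [p [Hp Heq]].
      assert (0 <= (l0 i - l0 1%nat) * p).
      { apply Rmult_le_pos; [|lra]. specialize (Hmin i Hi). lra. }
      lra.
    - exact (Hmax T' l' rho' HT' Hs'). }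
  destruct (riccati_trichotomy (l 1%nat)
              (fun t => - l 1%nat t ^ 2 + k / INR n * (rho t - cb))
              (k / INR n * cb) 0 T) as [H|[H|[L H]]]; order_side.
  - intros t Ht. apply (riccati_solution n k cb rho0 l0 T l rho 1 t); auto; lia.
  - intros t Ht. apply (riccati_solution n k cb rho0 l0 T l rho 1 t); auto; lia.
  - exact H.
  - exfalso. apply (Hbd 0). apply (H (fun y => 0 <= y)). exists 0. intros y Hy. apply Rlt_le, Hy.
  - exfalso. apply (Hbd (- (Rabs L + 1))).
    generalize (finite_limit_bounded _ _ _ H). apply filter_imp.
    intros t Ht. apply Rabs_def2 in Ht. lra.
Qed.

(* With [A = - l 1], [A ^ 2 / rho] would tend to minus infinity. *)
Lemma not_all_equal n k cb rho0 l0 T l rho :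
  (2 <= n)%nat -> 0 < k -> 0 < cb -> 0 < rho0 -> 0 < T ->
  is_solution n k cb rho0 l0 T l rho ->
  filterlim (l 1%nat) (at_left T) (Rbar_locally m_infty) ->
  ~ (forall i, (1 <= i <= n)%nat -> l0 i = l0 1%nat).
Proof.
  intros Hn Hk Hcb Hrho0 HT Hsol Hl1 Heq.
  assert (HnR : 2 <= INR n) by (apply (le_INR 2); exact Hn).
  assert (Hm : 0 < k / INR n) by (apply Rdiv_lt_0_compat; lra).
  assert (Hkap : 0 < k / INR n * cb) by (apply Rmult_lt_0_compat; auto).
  pose proof (solution_rho_pos _ _ _ _ _ _ _ _ Hrho0 Hsol) as Hpos.
  assert (Hric : forall t, 0 < t < T -> _)
    by (intros t Ht; exact (riccati_solution n k cb rho0 l0 T l rho 1 t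
          ltac:(lia) Hk Hcb Hrho0 Hsol ltac:(lia) Ht)).
  set (m := k / INR n) in *. cbv beta in Hric.
  assert (Hrho : forall t, 0 < t < T -> is_derive rho t (- rho t * (INR n * l 1%nat t))).
  { intros t Ht. replace (INR n * l 1%nat t) with (lam_sum n l t).
    - destruct Hsol as [_ [_ [_ [_ Hd]]]]. apply Hd, Ht.
    - rewrite lam_sum_index_sum.
      assert (Hi : forall i, (1 <= i <= n)%nat -> l i t = l 1%nat t).
      { intros i Hi.
        destruct (solution_gap _ _ _ _ _ _ _ _ 1%nat i Hsol ltac:(lia) Hi t Ht) as [p [Hp He]].
        rewrite (Heq i Hi), Rminus_diag, Rmult_0_l in He. lra. }
      apply Rle_antisym; [apply index_sum_le|apply index_sum_ge];
        intros i Hi'; rewrite (Hi i Hi'); lra. }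
  (* First comparison: [(- ln rho)' = n l_1], so [rho] tends to infinity. *)
  assert (Hln : filterlim (fun t => - ln (rho t)) (at_left T) (Rbar_locally m_infty)).
  { apply (riccati_comparison (l 1%nat) (fun t => - l 1%nat t ^ 2 + m * (rho t - cb))
             _ (fun t => INR n * l 1%nat t) (m * cb) 0 (INR n) 0 T); order_side.
    - intros t Ht. apply Hric, Ht.
    - intros t Ht. apply Hric, Ht.
    - exact Hl1.
    - intros t Ht. specialize (Hpos t Ht).
      replace (INR n * l 1%nat t) with (- ((- rho t * (INR n * l 1%nat t)) / rho t))
        by (field; lra).
      apply is_derive_neg_ln; auto.
    - intros t Ht. lra. }
  (* Once [rho > 2 cb], the factor [2 - 2 cb / rho] in the next derivative is at least 1. *)
  destruct (at_left_interval T _ HT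
              (filter_and _ _ (filterlim_m_infty_lt _ _ (- ln (2 * cb)) Hln)
                 (filterlim_m_infty_lt _ _ 0 Hl1))) as [t0 [Ht0 Hev]].
  assert (Hbig : forall t, t0 < t < T -> 2 * cb < rho t /\ l 1%nat t < 0).
  { intros t Ht. specialize (Hpos t ltac:(lra)). destruct (Hev t Ht) as [H1 H2].
    split; [|exact H2]. apply ln_lt_inv; lra. }
  (* Second comparison: the cubic term of the derivative is nonpositive because [n >= 2] and
     [l_1 < 0], and the rest is at most [m l_1]. *)
  assert (HZ : filterlim (fun t => l 1%nat t * l 1%nat t / rho t) (at_left T)
                 (Rbar_locally m_infty)).
  { apply (riccati_comparison (l 1%nat) (fun t => - l 1%nat t ^ 2 + m * (rho t - cb))
      _ (fun t => (INR n - 2) * (l 1%nat t ^ 3 / rho t)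
                  + m * l 1%nat t * (2 - 2 * cb / rho t)) (m * cb) 0 m t0 T); order_side.
    - intros t Ht. apply Hric. lra.
    - intros t Ht. apply Hric. lra.
    - exact Hl1.
    - intros t Ht. specialize (Hpos t ltac:(lra)).
      destruct (Hric t ltac:(lra)) as [Hd _]. specialize (Hrho t ltac:(lra)).
      pose proof (is_derive_Rdiv (fun t => l 1%nat t * l 1%nat t) rho t _ _
                    (is_derive_Rmult _ _ _ _ _ Hd Hd) Hrho ltac:(lra)) as HD.
      cbv beta in HD. eapply is_derive_eq; [exact HD|]. field. lra.
    - intros t Ht. destruct (Hbig t Ht) as [Hb Hneg].
      assert (2 * cb / rho t <= 1) by (apply Rle_div_l; lra).
      assert (l 1%nat t ^ 3 / rho t <= 0).
      { apply Rle_div_l; [lra|]. rewrite Rmult_0_l. nra. }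
      assert ((INR n - 2) * (l 1%nat t ^ 3 / rho t) <= 0) by nra.
      assert (m * l 1%nat t < 0) by nra. nra. }
  destruct (at_left_interval T _ HT (filterlim_m_infty_lt _ _ 0 HZ)) as [t1 [Ht1 Hneg]].
  set (s := (t1 + T) / 2). specialize (Hneg s ltac:(unfold s; lra)).
  specialize (Hpos s ltac:(unfold s; lra)).
  assert (0 <= l 1%nat s * l 1%nat s / rho s); [|lra].
  apply Rle_div_r; nra.
Qed.

(* [- l_j / (l_j - l_1)] is positive, but its derivative is at most [l_j] up to a
   constant, so it would tend to minus infinity. *)
Lemma above_minimum_not_m_infty n k cb rho0 l0 T l rho j :
  (1 <= n)%nat -> 0 < k -> 0 < cb -> 0 < rho0 -> 0 < T ->
  is_solution n k cb rho0 l0 T l rho ->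
  filterlim (l 1%nat) (at_left T) (Rbar_locally m_infty) ->
  (1 <= j <= n)%nat -> l0 1%nat < l0 j ->
  ~ filterlim (l j) (at_left T) (Rbar_locally m_infty).
Proof.
  intros Hn Hk Hcb Hrho0 HT Hsol Hl1 Hj Hlt Hlj.
  assert (HnR : 0 < INR n) by (apply lt_0_INR; lia).
  assert (Hm : 0 < k / INR n) by (apply Rdiv_lt_0_compat; lra).
  assert (Hkap : 0 < k / INR n * cb) by (apply Rmult_lt_0_compat; auto).
  pose proof (solution_rho_pos _ _ _ _ _ _ _ _ Hrho0 Hsol) as Hpos.
  assert (Hric : forall i t, (1 <= i <= n)%nat -> 0 < t < T -> _)
    by (intros i t Hi Ht; exact (riccati_solution n k cb rho0 l0 T l rho i t
          Hn Hk Hcb Hrho0 Hsol Hi Ht)).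
  set (m := k / INR n) in *. cbv beta in Hric.
  assert (Hgap : forall t, 0 < t < T -> 0 < l j t - l 1%nat t).
  { intros t Ht.
    destruct (solution_gap _ _ _ _ _ _ _ _ 1%nat j Hsol ltac:(lia) Hj t Ht) as [p [Hp ->]].
    apply Rmult_lt_0_compat; lra. }
  assert (HD : forall t, 0 < t < T ->
    is_derive (fun t => l j t - l 1%nat t) t (- (l 1%nat t + l j t) * (l j t - l 1%nat t))).
  { intros t Ht. destruct (Hric 1%nat t ltac:(lia) Ht) as [H1 _].
    destruct (Hric j t Hj Ht) as [H2 _].
    eapply is_derive_eq; [exact (is_derive_Rminus _ _ _ _ _ H2 H1)|]. ring. }
  destruct (at_left_interval T _ HT
              (filter_and _ _ (filterlim_m_infty_lt _ _ 0 Hl1)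
                 (filterlim_m_infty_lt _ _ 0 Hlj))) as [t0 [Ht0 Hev]].
  set (t1 := (t0 + T) / 2). assert (Ht1 : t0 < t1 < T) by (unfold t1; lra).
  set (D := l j t1 - l 1%nat t1).
  assert (HD0 : 0 < D) by (apply Hgap; lra).
  (* The gap grows while [l_1] and [l_j] are both negative. *)
  assert (HDle : forall t, t1 <= t < T -> D <= l j t - l 1%nat t).
  { intros t Ht. enough (- (l j t - l 1%nat t) <= - D) by lra.
    apply (derive_nonpos_le (fun t => - (l j t - l 1%nat t))
             (fun t => - (- (l 1%nat t + l j t) * (l j t - l 1%nat t)))); [lra| |].
    - intros u Hu. apply is_derive_Ropp. apply HD. lra.
    - intros u Hu. destruct (Hev u ltac:(lra)). specialize (Hgap u ltac:(lra)). nra. }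
  assert (Hx : filterlim (fun t => - (l j t / (l j t - l 1%nat t))) (at_left T)
                 (Rbar_locally m_infty)).
  { apply (riccati_comparison (l j) (fun t => - l j t ^ 2 + m * (rho t - cb))
      _ (fun t => - ((m * (rho t - cb) + l 1%nat t * l j t) / (l j t - l 1%nat t)))
      (m * cb) (m * cb / D) 1 t1 T); order_side.
    - intros t Ht. apply Hric; auto; lra.
    - intros t Ht. apply Hric; auto; lra.
    - exact Hlj.
    - intros t Ht. specialize (Hgap t ltac:(lra)).
      destruct (Hric j t Hj ltac:(lra)) as [H2 _].
      pose proof (is_derive_Ropp _ _ _
        (is_derive_Rdiv (l j) (fun t => l j t - l 1%nat t) t _ _ H2 (HD t ltac:(lra)) ltac:(lra)))
        as Hq.
      cbv beta in Hq. eapply is_derive_eq; [exact Hq|]. field. lra.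
    - intros t Ht. specialize (HDle t ltac:(lra)). destruct (Hev t ltac:(lra)) as [Hn1 Hnj].
      specialize (Hpos t ltac:(lra)).
      set (G := l j t - l 1%nat t) in *.
      (* Eliminating [l_1] splits the derivative into [m cb / G], bounded since [G >= D], the wanted
         [l_j], and a nonpositive remainder. *)
      replace (l 1%nat t) with (l j t - G) by (unfold G; ring).
      replace (- ((m * (rho t - cb) + (l j t - G) * l j t) / G))
        with (m * cb / G + 1 * l j t + - ((m * rho t + l j t ^ 2) / G)) by (field; lra).
      assert (m * cb / G <= m * cb / D).
      { apply Rmult_le_compat_l; [lra|]. apply Rinv_le_contravar; lra. }
      assert (0 <= (m * rho t + l j t ^ 2) / G).
      { apply Rle_div_r; [lra|]. nra. }
      lra. }
  destruct (at_left_interval T _ HT (filterlim_m_infty_lt _ _ 0 Hx)) as [t2 [Ht2 Hneg]].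
  set (s := (Rmax t1 t2 + T) / 2).
  assert (Hs : t1 < s /\ t2 < s /\ s < T).
  { unfold s. pose proof (Rmax_l t1 t2). pose proof (Rmax_r t1 t2).
    assert (Rmax t1 t2 < T) by (apply Rmax_lub_lt; lra). lra. }
  specialize (Hneg s ltac:(lra)). specialize (Hgap s ltac:(lra)).
  destruct (Hev s ltac:(lra)) as [_ Hnj].
  assert (0 <= (- l j s) / (l j s - l 1%nat s)) by (apply Rle_div_r; lra).
  unfold Rdiv in *. lra.
Qed.

(* If [l_j] stays bounded then all the [l_i] are bounded above, so
   [(ln rho)' >= - l_1 - const]: hence [rho] dominates [- l_1], whose integral
   diverges, and [l_j' >= rho - const] contradicts the boundedness. *)
Lemma no_finite_limit n k cb rho0 l0 T l rho j (L : R) :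
  (1 <= n)%nat -> 0 < k -> 0 < cb -> 0 < rho0 -> 0 < T ->
  is_solution n k cb rho0 l0 T l rho ->
  filterlim (l 1%nat) (at_left T) (Rbar_locally m_infty) ->
  (1 <= j <= n)%nat -> ~ filterlim (l j) (at_left T) (locally L).
Proof.
  intros Hn Hk Hcb Hrho0 HT Hsol Hl1 Hj Hlim.
  assert (HnR : 0 < INR n) by (apply lt_0_INR; lia).
  assert (Hm : 0 < k / INR n) by (apply Rdiv_lt_0_compat; lra).
  assert (Hkap : 0 < k / INR n * cb) by (apply Rmult_lt_0_compat; auto).
  pose proof (solution_rho_pos _ _ _ _ _ _ _ _ Hrho0 Hsol) as Hpos.
  assert (Hric : forall i t, (1 <= i <= n)%nat -> 0 < t < T -> _)
    by (intros i t Hi Ht; exact (riccati_solution n k cb rho0 l0 T l rho i t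
          Hn Hk Hcb Hrho0 Hsol Hi Ht)).
  set (m := k / INR n) in *. cbv beta in Hric.
  destruct (at_left_interval T _ HT (finite_limit_bounded _ _ _ Hlim)) as [t0 [Ht0 Hb]].
  set (M := Rabs L + 1) in *. assert (HM : 1 <= M) by (unfold M; pose proof (Rabs_pos L); lra).
  set (t1 := (t0 + T) / 2). assert (Ht1 : t0 < t1 < T) by (unfold t1; lra).
  set (S1 := index_sum n (fun i => Rabs (l i t1))).
  assert (HS1 : forall i, (1 <= i <= n)%nat -> Rabs (l i t1) <= S1).
  { intros i Hi. apply (index_sum_ge_term n i (fun i => Rabs (l i t1))); auto.
    intros; apply Rabs_pos. }
  assert (HS0 : 0 <= S1) by (eapply Rle_trans; [apply Rabs_pos|apply (HS1 1%nat); lia]).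
  (* From [(l_i - l_j)' = l_j ^ 2 - l_i ^ 2 <= M ^ 2]; the two [M] bound [l_j] at [t] and at [t1],
     and [S1] bounds [l_i] at [t1]. *)
  set (K := S1 + 2 * M + M ^ 2 * T).
  assert (HMT : 0 <= M ^ 2 * T) by (apply Rmult_le_pos; nra).
  assert (HK : forall t i, t1 < t < T -> (1 <= i <= n)%nat -> l i t <= K).
  { intros t i Ht Hi.
    assert (Hle : l i t - l j t <= l i t1 - l j t1 + M ^ 2 * (t - t1)).
    { apply (le_of_derive_le (fun t => l i t - l j t) (fun t => - l i t ^ 2 + l j t ^ 2));
        [lra| |].
      - intros u Hu. destruct (Hric i u Hi ltac:(lra)) as [H1 _].
        destruct (Hric j u Hj ltac:(lra)) as [H2 _].
        eapply is_derive_eq; [exact (is_derive_Rminus _ _ _ _ _ H1 H2)|]. ring.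
      - intros u Hu. specialize (Hb u ltac:(lra)). apply Rabs_def2 in Hb. nra. }
    assert (M ^ 2 * (t - t1) <= M ^ 2 * T) by (apply Rmult_le_compat_l; nra).
    pose proof (Hb t ltac:(lra)) as Hbt. pose proof (Hb t1 ltac:(lra)) as Hbt1.
    apply Rabs_def2 in Hbt. apply Rabs_def2 in Hbt1.
    specialize (HS1 i Hi). apply Rabs_le_between in HS1. unfold K. lra. }
  assert (HK0 : 0 <= K) by (unfold K; lra).
  (* Here [(- ln rho)'] is the sum of the [l i], at most [l_1 + n K]. The result
     [ln (- l_1) - ln rho <= C] reads [rho >= exp (- C) (- l_1)]. *)
  destruct (riccati_log_bound (l 1%nat) (fun t => - l 1%nat t ^ 2 + m * (rho t - cb))
              (fun t => - ln (rho t)) (fun t => lam_sum n l t)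
              (m * cb) (INR n * K) 1 t1 T) as [C HC]; order_side.
  - intros t Ht. apply Hric; [lia|lra].
  - intros t Ht. apply Hric; [lia|lra].
  - exact Hl1.
  - intros t Ht. specialize (Hpos t ltac:(lra)).
    replace (lam_sum n l t) with (- ((- rho t * lam_sum n l t) / rho t)) by (field; lra).
    apply is_derive_neg_ln; auto. destruct Hsol as [_ [_ [_ [_ Hd]]]]. apply Hd. lra.
  - intros t Ht. rewrite lam_sum_index_sum.
    pose proof (index_sum_le_first n (fun i => l i t) K Hn HK0
                  (fun i Hi => HK t i Ht Hi)). cbv beta in *. lra.
  - destruct (at_left_interval T _ HT HC) as [t2 [Ht2 HC']].
    set (t3 := Rmax t1 t2).
    assert (Ht3 : t1 <= t3 /\ t2 <= t3 /\ t3 < T).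
    { unfold t3. split; [apply Rmax_l|split; [apply Rmax_r|apply Rmax_lub_lt; lra]]. }
    (* [(- l_j)' = l_j ^ 2 + m cb - m rho], where [l_j ^ 2 <= M ^ 2] and
       [- m rho <= m exp (- C) l_1]. *)
    assert (Hopp : filterlim (fun t => - l j t) (at_left T) (Rbar_locally m_infty)).
    { apply (riccati_comparison (l 1%nat) (fun t => - l 1%nat t ^ 2 + m * (rho t - cb))
        _ (fun t => - (- l j t ^ 2 + m * (rho t - cb)))
        (m * cb) (M ^ 2 + m * cb) (m * exp (- C)) t3 T); order_side.
      - apply Rmult_lt_0_compat; [lra|apply exp_pos].
      - intros t Ht. apply Hric; [lia|lra].
      - intros t Ht. apply Hric; [lia|lra].
      - exact Hl1.
      - intros t Ht. apply is_derive_Ropp. apply Hric; [auto|lra].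
      - intros t Ht. specialize (Hb t ltac:(lra)). apply Rabs_def2 in Hb.
        destruct (HC' t ltac:(lra)) as [Hneg Hlog]. specialize (Hpos t ltac:(lra)).
        assert (Hdom : exp (- C) * - l 1%nat t <= rho t).
        { rewrite <- (exp_ln (- l 1%nat t)), <- (exp_ln (rho t)), <- exp_plus by lra.
          assert (Hl : - C + ln (- l 1%nat t) <= ln (rho t)) by lra.
          destruct Hl as [Hl|Hl]; [left; apply exp_increasing, Hl|rewrite Hl; lra]. }
        assert (m * (exp (- C) * - l 1%nat t) <= m * rho t)
          by (apply Rmult_le_compat_l; lra).
        nra. }
    destruct (at_left_interval T _ HT (filterlim_m_infty_lt _ _ (- M) Hopp)) as [t4 [Ht4 Hneg]].
    set (s := (Rmax t0 t4 + T) / 2).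
    assert (Hs : t0 < s /\ t4 < s /\ s < T).
    { unfold s. pose proof (Rmax_l t0 t4). pose proof (Rmax_r t0 t4).
      assert (Rmax t0 t4 < T) by (apply Rmax_lub_lt; lra). lra. }
    specialize (Hneg s ltac:(lra)). specialize (Hb s ltac:(lra)).
    apply Rabs_def2 in Hb. lra.
Qed.

Theorem theorem3p2 (n J : nat) (k cb rho0 : R) (l0 : nat -> R) (tB : R)
    (l : nat -> R -> R) (rho : R -> R) :
  (2 <= n)%nat -> 0 < k -> 0 < cb -> 0 < rho0 ->
  (1 <= J <= n)%nat ->
  (forall i, (1 <= i <= J)%nat -> l0 i = l0 1%nat) ->
  ((J < n)%nat -> l0 J < l0 (S J)) ->
  (forall i, (J < i < n)%nat -> l0 i <= l0 (S i)) ->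
  0 < tB ->
  maximal_solution n k cb rho0 l0 tB l rho ->
  (1 <= J < n)%nat /\
  (forall i, (1 <= i <= J)%nat ->
     filterlim (l i) (at_left tB) (Rbar_locally m_infty)) /\
  (forall i, (J < i <= n)%nat ->
     filterlim (l i) (at_left tB) (Rbar_locally p_infty)).
Proof.
  intros Hn Hk Hcb Hrho0 HJ HeqJ HltJ Hmono HT Hmax.
  assert (Habove : forall i, (J < i <= n)%nat -> l0 1%nat < l0 i).
  { induction i as [|i IH]; intros Hi; [lia|].
    destruct (Nat.eq_dec i J) as [->|Hne].
    - rewrite <- (HeqJ J) by lia. apply HltJ. lia.
    - apply Rlt_le_trans with (l0 i); [apply IH|apply Hmono]; lia. }
  assert (Hmin : forall i, (1 <= i <= n)%nat -> l0 1%nat <= l0 i).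
  { intros i Hi. destruct (Nat.le_gt_cases i J) as [H|H]; [rewrite (HeqJ i) by lia; lra|].
    left. apply Habove. lia. }
  assert (Hl1 : filterlim (l 1%nat) (at_left tB) (Rbar_locally m_infty))
    by (apply (minimum_tends_to_m_infty n k cb rho0 l0 tB l rho); auto; lia).
  destruct Hmax as [Hsol _].
  split; [|split].
  (* If [J = n], all initial values coincide. *)
  - split; [lia|]. destruct (Nat.eq_dec J n) as [->|Hne]; [|lia].
    exfalso. exact (not_all_equal n k cb rho0 l0 tB l rho Hn Hk Hcb Hrho0 HT Hsol Hl1 HeqJ).
  (* Equal initial values give a zero gap, so [l i] agrees with [l 1] on the open interval. *)
  - intros i Hi. apply (filterlim_ext_loc (l 1%nat)); [|exact Hl1].
    apply at_leftP. exists 0. split; [exact HT|]. intros t Ht.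
    destruct (solution_gap _ _ _ _ _ _ _ _ 1%nat i Hsol ltac:(lia) ltac:(lia) t Ht)
      as [p [_ He]].
    rewrite (HeqJ i Hi), Rminus_diag, Rmult_0_l in He. lra.
  - intros i Hi.
    assert (Hkap : 0 < k / INR n * cb).
    { apply Rmult_lt_0_compat; auto. apply Rdiv_lt_0_compat; auto. apply lt_0_INR; lia. }
    (* Of the three possible limits, minus infinity is excluded by [l0 1 < l0 i], and a finite one
       by the divergence of [l 1]. *)
    destruct (riccati_trichotomy (l i) (fun t => - l i t ^ 2 + k / INR n * (rho t - cb))
                (k / INR n * cb) 0 tB) as [H|[H|[L H]]]; order_side.
    + intros t Ht. apply (riccati_solution n k cb rho0 l0 tB l rho i t); auto; lia.
    + intros t Ht. apply (riccati_solution n k cb rho0 l0 tB l rho i t); auto; lia.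
    + exfalso. revert H.
      apply (above_minimum_not_m_infty n k cb rho0 l0 tB l rho); auto; try lia.
    + exact H.
    + exfalso. revert H.
      apply (no_finite_limit n k cb rho0 l0 tB l rho); auto; try lia.
Qed.
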